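(* Let $n,p\ge 1$, $A\in\mathbb{R}^{n\times n}$, $B\in\mathbb{R}^{n\times p}$, and consider a bounded-input bounded-output linear discrete-time system $$x_{t+1}=Ax_t+Bu_t,\qquad y_t=x_t,\qquad t\in\mathbb{Z}_+=\{0,1,2,\dots\},$$ with $x_t\in\mathbb{R}^n$ and $u_t\in\mathbb{R}^p$. Write $r_t=[x_t^{\mathrm T}\; u_t^{\mathrm T}]^{\mathrm T}\in\mathbb{R}^{n+p}$. Suppose there exist real numbers $\alpha,\beta>0$ and an integer $T>0$ such that $$\alpha I_{n+p}\preceq\sum_{\tau=t}^{t+T} r_\tau r_\tau^{\mathrm T}\preceq\beta I_{n+p}\qquad\text{for all } t\ge 0 .$$ Then there is some $\gamma>0$ such that the augmented parameter matrix $\hat\Theta_t=[\hat A_t\,|\,\hat B_t]\in\mathbb{R}^{n\times(n+p)}$, started from any initial matrix $\hat\Theta_0$ and updated by the recursion $$\hat\Theta_{t+1}=\hat\Theta_t-\gamma\,(\hat\Theta_t r_t-x_{t+1})\,r_t^{\mathrm T},\qquad t\ge 0,$$ converges asymptotically to $\Theta=[A\,|\,B]$, i.e. $\hat\Theta_t\to\Theta$ as $t\to\infty$.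
   Context: For symmetric matrices, $M\preceq N$ means that $N-M$ is positive semidefinite. $I_k$ is the $k\times k$ identity matrix. $[A\,|\,B]$ denotes horizontal concatenation. Bounded-input bounded-output means that every bounded input sequence produces a bounded output sequence. *)

(* Defs.v *)
From mathcomp Require Import all_boot all_order all_algebra.
From mathcomp Require Import all_classical all_reals all_analysis.

Set Implicit Arguments.
Unset Strict Implicit.
Unset Printing Implicit Defensive.

Import Order.TTheory GRing.Theory Num.Theory.
Import numFieldNormedType.Exports.

Local Open Scope classical_set_scope.
Local Open Scope ring_scope.

Definition psdmx (R : realType) (k : nat) (M : 'M[R]_k) : Prop :=
  M \is symmetricmx /\ forall v : 'cV[R]_k, 0 <= (v^T *m M *m v) 0 0.

Definition loewner_le (R : realType) (k : nat) (M N : 'M[R]_k) : Prop :=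
  psdmx (N - M).

Definition lti_trajectory (R : realType) (n p : nat)
    (A : 'M[R]_n) (B : 'M[R]_(n, p))
    (x : nat -> 'cV[R]_n) (u : nat -> 'cV[R]_p) : Prop :=
  forall t, x t.+1 = A *m x t + B *m u t.

(* The output is the full state, y_t = x_t. As usual for input-output stability
   the response is taken from the zero initial state; requiring boundedness from
   other initial states as well would be a stronger condition on (A, B). *)
Definition bibo (R : realType) (n p : nat)
    (A : 'M[R]_n) (B : 'M[R]_(n, p)) : Prop :=
  forall (x : nat -> 'cV[R]_n) (u : nat -> 'cV[R]_p),
    lti_trajectory A B x u -> x 0%N = 0 -> bounded_fun u -> bounded_fun x.

Definition regressor (R : realType) (n p : nat)
    (x : nat -> 'cV[R]_n) (u : nat -> 'cV[R]_p) (t : nat) : 'cV[R]_(n + p) :=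
  col_mx (x t) (u t).

(* Main.v *)
(* With gamma = 1/beta, the excitation upper bound gives |r_t|^2 <= beta, so each
   row e_t of the error Theta_t - [A|B] satisfies
   |e_(t+1)|^2 <= |e_t|^2 - gamma (e_t . r_t)^2; hence |e_t|^2 decreases and the
   prediction errors d_t = e_t . r_t tend to 0. Over a window of length T + 1 the
   row e_t moves only by combinations of d_t, ..., d_(t+T), so e_t . r_tau tends
   to 0 uniformly for tau in the window, and the excitation lower bound
   alpha |e_t|^2 <= sum_tau (e_t . r_tau)^2 forces e_t to 0. *)
Require Import Defs.
From mathcomp Require Import all_boot all_order all_algebra.
From mathcomp Require Import all_classical all_reals all_analysis.
From mathcomp Require Import lra.
Set Implicit Arguments.
Unset Strict Implicit.
Unset Printing Implicit Defensive.

Import Order.TTheory GRing.Theory Num.Theory.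
Import numFieldNormedType.Exports.
Local Open Scope classical_set_scope.
Local Open Scope ring_scope.

Definition dot {R : realType} {k : nat} (v w : 'cV[R]_k) : R := (v^T *m w) 0 0.

Section Dot.
Variables (R : realType) (k : nat).
Implicit Types u v w : 'cV[R]_k.

Lemma dotE v w : dot v w = \sum_i v i 0 * w i 0.
Proof. by rewrite /dot mxE; apply: eq_bigr => i _; rewrite mxE. Qed.

Lemma dotC v w : dot v w = dot w v.
Proof. by rewrite !dotE; apply: eq_bigr => i _; rewrite mulrC. Qed.

Lemma dotBl u v w : dot (u - v) w = dot u w - dot v w.
Proof. by rewrite /dot raddfB mulmxBl !mxE. Qed.

Lemma dotZl a v w : dot (a *: v) w = a * dot v w.
Proof. by rewrite /dot linearZ -scalemxAl mxE. Qed.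

Lemma dotBr u v w : dot u (v - w) = dot u v - dot u w.
Proof. by rewrite dotC dotBl 2!(dotC u). Qed.

Lemma dotZr a v w : dot v (a *: w) = a * dot v w.
Proof. by rewrite dotC dotZl dotC. Qed.

Lemma dot_ge0 v : 0 <= dot v v.
Proof. by rewrite dotE; apply: sumr_ge0 => i _; rewrite -expr2 sqr_ge0. Qed.

Lemma sqr_coord_le_dot v i : v i 0 ^+ 2 <= dot v v.
Proof.
rewrite dotE (bigD1 i)//= -expr2 lerDl.
by apply: sumr_ge0 => j _; rewrite -expr2 sqr_ge0.
Qed.

(** Since |v - w|^2 and |v + w|^2 are nonnegative, 2|v . w| <= |v|^2 + |w|^2 <= 2b; no square root
    is needed. *)
Lemma normr_dot_le b v w : dot v v <= b -> dot w w <= b -> `|dot v w| <= b.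
Proof.
move=> vb wb; rewrite ler_norml.
have := dot_ge0 (v - w); have := dot_ge0 (v - (-1) *: w).
rewrite !dotBl !dotBr !dotZl !dotZr (dotC w v) => h1 h2.
by apply/andP; split; lra.
Qed.

Lemma quad_outer v w : (v^T *m (w *m w^T) *m v) 0 0 = dot v w ^+ 2.
Proof.
rewrite mulmxA -mulmxA mxE big_ord1 expr2.
by rewrite -[X in _ * X]/(dot w v) (dotC w v).
Qed.

Lemma quad_gram v (r : nat -> 'cV[R]_k) a b :
  (v^T *m (\sum_(a <= t < b) r t *m (r t)^T) *m v) 0 0 =
  \sum_(a <= t < b) dot v (r t) ^+ 2.
Proof.
rewrite mulmx_sumr mulmx_suml summxE.
by apply: eq_bigr => t _; exact: quad_outer.
Qed.

Lemma quad_scalar v a : (v^T *m a%:M *m v) 0 0 = a * dot v v.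
Proof. by rewrite mul_mx_scalar -scalemxAl mxE. Qed.

Lemma loewner_leP (M N : 'M[R]_k) v :
  loewner_le M N -> (v^T *m M *m v) 0 0 <= (v^T *m N *m v) 0 0.
Proof. by case=> _ /(_ v); rewrite mulmxBr mulmxBl !mxE subr_ge0. Qed.

End Dot.

Lemma sqr_cvg0 (R : realType) (f : nat -> R) :
  f t ^+ 2 @[t --> \oo] --> 0 -> f @ \oo --> 0.
Proof.
move=> f2; apply/cvgr0Pnorm_lt => eps eps0.
move/cvgr0Pnorm_lt : f2 => /(_ _ (exprn_gt0 2 eps0)).
apply: filterS => t; rewrite normrX ltr_pXn2r ?nnegrE//.
exact: ltW.
Qed.

Section LeastMeanSquares.
Variables (R : realType) (k T : nat) (r e : nat -> 'cV[R]_k) (alpha beta : R).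
Hypotheses (alpha_gt0 : 0 < alpha) (beta_gt0 : 0 < beta).
Hypothesis excited : forall t v,
  alpha * dot v v <= \sum_(t <= s < (t + T).+1) dot v (r s) ^+ 2 <= beta * dot v v.
(** Here [e] stands for one row of the parameter error, transposed; the matrix recursion acts on
    each row separately. *)
Hypothesis eS : forall t, e t.+1 = e t - (beta^-1 * dot (e t) (r t)) *: r t.

(** Test the upper bound on v = r_t: the summand s = t alone is |r_t|^4, so |r_t|^4 <= beta |r_t|^2,
    and a nonzero |r_t|^2 cancels. *)
Lemma regressor_bound t : dot (r t) (r t) <= beta.
Proof.
have [->|nz] := eqVneq (dot (r t) (r t)) 0; first exact: ltW.
have rt0 : 0 < dot (r t) (r t) by rewrite lt_def nz dot_ge0.
have /andP[_] := excited t (r t).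
rewrite big_ltn ?ltnS ?leq_addr// => le_beta.
rewrite -(ler_pM2r rt0) -expr2; apply: le_trans le_beta.
by rewrite lerDl; apply: sumr_ge0 => s _; exact: sqr_ge0.
Qed.

Lemma error_decrease t :
  beta^-1 * dot (e t) (r t) ^+ 2 <= dot (e t) (e t) - dot (e t.+1) (e t.+1).
Proof.
rewrite eS !dotBl !dotBr !dotZl !dotZr (dotC (r t) (e t)).
set d := dot (e t) (r t); set q := dot (r t) (r t).
have g0 : 0 < beta^-1 by rewrite invr_gt0.
have gq : beta^-1 * q <= 1 by rewrite mulrC ler_pdivrMr // mul1r regressor_bound.
have gd : 0 <= beta^-1 * d ^+ 2 by rewrite mulr_ge0 ?sqr_ge0 ?ltW.
(* After expanding |e_(t+1)|^2, this product is exactly the right side minus the left side of the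
   goal. *)
have : 0 <= beta^-1 * d ^+ 2 * (1 - beta^-1 * q) by rewrite mulr_ge0 ?subr_ge0.
by lra.
Qed.

Lemma prediction_error_cvg0 : dot (e t) (r t) @[t --> \oo] --> 0.
Proof.
pose V t := dot (e t) (e t).
have V_ni : nonincreasing_seq V.
  apply/nonincreasing_seqP => t; rewrite -subr_ge0.
  apply: le_trans (error_decrease t).
  by rewrite mulr_ge0 ?sqr_ge0// invr_ge0 ltW.
have V_lb : has_lbound (range V).
  by exists 0 => _ [t _ <-]; exact: dot_ge0.
have V_cvg := nonincreasing_cvgn V_ni V_lb.
have VS_cvg : V t.+1 @[t --> \oo] --> inf (range V) by rewrite cvg_shiftS.
apply: sqr_cvg0.
(* [V] and its shift have the same limit, so the decrements that dominate the squared prediction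
   errors vanish. *)
apply: (@squeeze_cvgr _ _ _ _ (fun=> 0) (fun t => beta * (V t - V t.+1))).
- apply: nearW => t; rewrite sqr_ge0/=.
  by rewrite -ler_pdivrMl //; exact: error_decrease.
- exact: cvg_cst.
- have -> : 0 = beta * (inf (range V) - inf (range V)) by rewrite subrr mulr0.
  by apply: cvgMr; apply: cvgB.
Qed.

(** Replacing e_t by e_(s+t) costs one term per update, of weight |r_(j+t) . r_(s+t)| / beta <= 1.
    The last summand, j = s, is the prediction error at time s + t itself. *)
Lemma window_prediction_error t s :
  `|dot (e t) (r (s + t)%N)| <=
  \sum_(j < s.+1) `|dot (e (j + t)%N) (r (j + t)%N)|.
Proof.
have drift m : (m <= s)%N ->
    `|dot (e t) (r (s + t)%N) - dot (e (m + t)%N) (r (s + t)%N)| <=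
    \sum_(j < m) `|dot (e (j + t)%N) (r (j + t)%N)|.
  elim: m => [_|m IHm ms]; first by rewrite big_ord0 add0n subrr normr0.
  rewrite big_ord_recr/= addSn eS dotBl dotZl opprB addrCA addrC.
  apply: le_trans (ler_normD _ _) _; apply: lerD; first exact: IHm (ltnW ms).
  rewrite !normrM (gtr0_norm (_ : 0 < beta^-1)) ?invr_gt0// -mulrA mulrCA.
  rewrite ler_piMr// mulrC ler_pdivrMr// mul1r.
  by apply: normr_dot_le; exact: regressor_bound.
rewrite big_ord_recr/= -[X in `|X|](subrK (dot (e (s + t)%N) (r (s + t)%N))).
by apply: le_trans (ler_normD _ _) _; rewrite lerD2r drift.
Qed.

Lemma lms_cvg0 : dot (e t) (e t) @[t --> \oo] --> 0.
Proof.
pose S t : R := \sum_(j < T.+1) `|dot (e (j + t)%N) (r (j + t)%N)|.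
have S_cvg0 : S @ \oo --> 0.
  have -> : 0 = \sum_(j < T.+1) `|0 : R| by rewrite normr0 big1.
  apply: (cvg_big add_continuous) => j _; apply: cvg_norm.
  exact: cvg_comp _ _ (cvg_addnl j) prediction_error_cvg0.
apply: (@squeeze_cvgr _ _ _ _ (fun=> 0)
    (fun t => alpha^-1 * (T.+1%:R * (S t * S t)))).
- apply: nearW => t; rewrite dot_ge0/= ler_pdivlMl//.
  have /andP[le_sum _] := excited t (e t); apply: le_trans le_sum _.
  rewrite -[X in \sum_(X <= _ < _) _]add0n big_addn subSn ?leq_addr// addKn big_mkord.
  (* Each of the T + 1 squares in the window is at most S_t^2, because the sum over j <= s is part
     of the full sum S_t. *)
  apply: (@le_trans _ _ (\sum_(s < T.+1) S t ^+ 2)); last first.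
    by rewrite sumr_const card_ord mulr_natl expr2.
  apply: ler_sum => s _; rewrite -[leLHS]real_normK ?num_real//.
  rewrite lerXn2r ?nnegrE//; first by apply: sumr_ge0 => j _.
  apply: le_trans (window_prediction_error t s) _.
  rewrite (big_ord_widen _ (fun j => `|dot (e (j + t)%N) (r (j + t)%N)|)
    (ltn_ord s)) big_mkcond.
  by apply: ler_sum => j _; case: ifP.
- exact: cvg_cst.
- have -> : 0 = alpha^-1 * (T.+1%:R * (0 * 0)) :> R by rewrite !mulr0.
  by apply: cvgMr; apply: cvgMr; apply: cvgM.
Qed.

End LeastMeanSquares.

Theorem theorem1 (R : realType) (n p : nat) (n_ge1 : (1 <= n)%N) (p_ge1 : (1 <= p)%N)
    (A : 'M[R]_n) (B : 'M[R]_(n, p))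
    (AB_bibo : bibo A B)
    (x : nat -> 'cV[R]_n) (u : nat -> 'cV[R]_p)
    (xu_traj : lti_trajectory A B x u)
    (exciting : exists (alpha beta : R) (T : nat),
      [/\ 0 < alpha, 0 < beta, (0 < T)%N &
        forall t : nat,
          let Gram := \sum_(t <= tau < (t + T).+1)
                     regressor x u tau *m (regressor x u tau)^T in
          loewner_le alpha%:M Gram /\ loewner_le Gram beta%:M]) :
  exists gamma : R, 0 < gamma /\
    forall Theta : nat -> 'M[R]_(n, n + p),
      (forall t : nat,
         Theta t.+1 = Theta t
           - gamma *: ((Theta t *m regressor x u t - x t.+1)
                         *m (regressor x u t)^T)) ->
      Theta @ \oo --> row_mx A B.
Proof.
have [alpha [beta [T [alpha0 beta0 _ gram]]]] := exciting.
exists beta^-1; split; first by rewrite invr_gt0.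
move=> Theta ThetaS; set r := regressor x u.
have excited t v : alpha * dot v v <=
    \sum_(t <= s < (t + T).+1) dot v (r s) ^+ 2 <= beta * dot v v.
  have [/(loewner_leP v) lo /(loewner_leP v) hi] := gram t.
  by move: lo hi; rewrite !quad_scalar quad_gram => -> ->.
have traj t : x t.+1 = row_mx A B *m r t by rewrite mul_row_col xu_traj.
pose e (i : 'I_n) t := (row i (Theta t - row_mx A B))^T.
have e_cvg i : dot (e i t) (e i t) @[t --> \oo] --> 0.
  apply: (lms_cvg0 (r := r) alpha0 beta0 excited) => t.
  (* With x_(t+1) = [A|B] r_t the residual becomes (Theta_t - [A|B]) r_t, whose i-th entry is the
     prediction error of row i. *)
  rewrite /e ThetaS traj -mulmxBl -/(r t) addrAC.
  set E := Theta t - row_mx A B.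
  rewrite /dot trmxK -row_mul; apply/matrixP => l j.
  by rewrite (ord1 j) !mxE big_ord1 !mxE mulrA.
apply/cvgrPdist_lt => eps eps0.
(* The matrix norm is the largest absolute entry, and finitely many entries allow one common
   threshold for t. *)
have : \forall t \near \oo, forall ij : 'I_n * 'I_(n + p),
    `|(row_mx A B - Theta t) ij.1 ij.2| < eps.
  apply: filter_forall => -[i j]/=.
  have /cvgr0Pnorm_lt/(_ _ (exprn_gt0 2 eps0)) := e_cvg i.
  apply: filterS => t; rewrite ger0_norm ?dot_ge0// => e_lt.
  have := le_lt_trans (sqr_coord_le_dot (e i t) j) e_lt.
  rewrite !mxE -(real_normK (num_real _)) ltr_pXn2r ?nnegrE//; last exact: ltW.
  by rewrite distrC.
apply: filterS => t lt_eps; rewrite /Num.norm/= mx_normrE.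
by apply: bigmax_lt.
Qed.
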